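(* Let $\mathbf{OMP}$ be the category of orthomodular posets and their morphisms, and let $\mathbf{BPosInv}$ be the category of bounded posets with involution and their morphisms. The forgetful functor $$G\colon \mathbf{OMP}\to\mathbf{BPosInv},$$ which sends each orthomodular poset to its underlying bounded poset with involution and each morphism to itself, is monadic.
   Context: A bounded poset is a structure $(P,\leq,0,1)$ where $\leq$ is a partial order on $P$ and $0,1\in P$ are its bottom and top elements. A morphism of bounded posets is an isotone (order-preserving) map $f$ with $f(0)=0$ and $f(1)=1$. An involution on a poset $P$ is a mapping ${}'\colon P\to P$ such that for all $x,y\in P$, $x\leq y$ if and only if $y'\leq x'$, and $x''=x$ for all $x\in P$. The objects of $\mathbf{BPosInv}$ are bounded posets with involution $(P,\leq,{}',0,1)$; its morphisms $f\colon P\to Q$ are the morphisms of bounded posets such that $f(x')=f(x)'$ for all $x\in P$. Elements $x,y$ of a bounded poset with involution are orthogonal, written $x\perp y$, if $x\leq y'$. An orthomodular poset is a bounded poset with involution $(A,\leq,{}',0,1)$ such that for all $x,y\in A$: (OMP1) $x\wedge x'=0$; (OMP2) if $x\perp y$, then $x\vee y$ exists; (OMP3) if $x\leq y$, then $x\vee(x\vee y')'=y$. A morphism of orthomodular posets $f\colon A_1\to A_2$ is a morphism of bounded posets with involution such that for all $x\perp y$ in $A_1$, $f(x)\perp f(y)$ and $f(x\vee y)=f(x)\vee f(y)$. These form the category $\mathbf{OMP}$. A functor $G\colon\mathcal D\to\mathcal C$ is monadic if and only if it is equivalent to the forgetful functor $U^T\colon\mathcal C^T\to\mathcal C$ from the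 Eilenberg–Moore category $\mathcal C^T$ of algebras for some monad $T$ on $\mathcal C$; that is, there are a monad $T$ on $\mathcal C$ and an equivalence of categories $K\colon\mathcal D\to\mathcal C^T$ with $U^T\circ K\cong G$. (In particular, a monadic functor is a right adjoint.) *)

(* Defs.v *)
From Stdlib Require Import Relation_Definitions.
From Stdlib Require Import FunctionalExtensionality ProofIrrelevance.

Set Implicit Arguments.
Unset Strict Implicit.

(* Hom-sets carry Leibniz equality, not a setoid. *)
Record Category : Type := {
  Obj :> Type;
  Hom : Obj -> Obj -> Type;
  idm : forall X, Hom X X;
  comp : forall X Y Z, Hom Y Z -> Hom X Y -> Hom X Z;
  comp_id_l : forall X Y (f : Hom X Y), comp (idm Y) f = f;
  comp_id_r : forall X Y (f : Hom X Y), comp f (idm X) = f;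
  comp_assoc : forall W X Y Z (h : Hom Y Z) (g : Hom X Y) (f : Hom W X),
    comp h (comp g f) = comp (comp h g) f
}.

Arguments Hom {c} X Y.
Arguments idm {c} X.
Arguments comp {c X Y Z} g f.

Declare Scope category_scope.
Open Scope category_scope.
Notation "g '∘' f" := (comp g f) (at level 40, left associativity)
  : category_scope.

Record Functor (C D : Category) : Type := {
  fobj :> C -> D;
  fmap : forall X Y : C, Hom X Y -> Hom (fobj X) (fobj Y);
  fmap_id : forall X : C, fmap (idm X) = idm (fobj X);
  fmap_comp : forall (X Y Z : C) (g : Hom Y Z) (f : Hom X Y),
    fmap (g ∘ f) = fmap g ∘ fmap f
}.

Arguments fmap {C D} F {X Y} f : rename.

Definition functor_id (C : Category) : Functor C C.
Proof.
refine {| fobj := fun X : C => X; fmap := fun X Y (f : Hom X Y) => f |};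
  reflexivity.
Defined.

Definition functor_comp (C D E : Category) (G : Functor D E) (F : Functor C D) :
  Functor C E.
Proof.
refine {| fobj := fun X : C => G (F X);
          fmap := fun X Y (f : Hom X Y) => fmap G (fmap F f) |}.
- intros X; now rewrite !fmap_id.
- intros X Y Z g f; now rewrite !fmap_comp.
Defined.

Record NatTrans (C D : Category) (F G : Functor C D) : Type := {
  ncomp :> forall X : C, Hom (F X) (G X);
  naturality : forall (X Y : C) (f : Hom X Y),
    ncomp Y ∘ fmap F f = fmap G f ∘ ncomp X
}.

Definition nat_isomorphic (C D : Category) (F G : Functor C D) : Prop :=
  exists (a : NatTrans F G) (b : NatTrans G F),
    forall X : C, b X ∘ a X = idm (F X) /\ a X ∘ b X = idm (G X).

Definition is_equivalence (C D : Category) (K : Functor C D) : Prop :=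
  exists L : Functor D C,
    nat_isomorphic (functor_comp L K) (functor_id C) /\
    nat_isomorphic (functor_comp K L) (functor_id D).

Record Monad (C : Category) : Type := {
  mfun :> Functor C C;
  unit_m : NatTrans (functor_id C) mfun;
  mult_m : NatTrans (functor_comp mfun mfun) mfun;
  mult_unit_l : forall X : C, mult_m X ∘ unit_m (mfun X) = idm (mfun X);
  mult_unit_r : forall X : C, mult_m X ∘ fmap mfun (unit_m X) = idm (mfun X);
  mult_mult : forall X : C,
    mult_m X ∘ mult_m (mfun X) = mult_m X ∘ fmap mfun (mult_m X)
}.

Record Algebra (C : Category) (T : Monad C) : Type := {
  alg_obj : C;
  alg_str : Hom (T alg_obj) alg_obj;
  alg_unit : alg_str ∘ unit_m T alg_obj = idm alg_obj;
  alg_mult : alg_str ∘ mult_m T alg_obj = alg_str ∘ fmap T alg_str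
}.

Record AlgebraHom (C : Category) (T : Monad C) (A B : Algebra T) : Type := {
  alg_hom : Hom (alg_obj A) (alg_obj B);
  alg_hom_str : alg_hom ∘ alg_str A = alg_str B ∘ fmap T alg_hom
}.

Lemma AlgebraHom_eq (C : Category) (T : Monad C) (A B : Algebra T)
  (f g : AlgebraHom A B) : alg_hom f = alg_hom g -> f = g.
Proof.
destruct f as [f Hf], g as [g Hg]; simpl; intros ->.
now rewrite (proof_irrelevance _ Hf Hg).
Qed.

Definition algebra_id (C : Category) (T : Monad C) (A : Algebra T) :
  AlgebraHom A A.
Proof.
exists (idm (alg_obj A)).
now rewrite fmap_id, comp_id_l, comp_id_r.
Defined.

Definition algebra_comp (C : Category) (T : Monad C) (A B D : Algebra T)
  (g : AlgebraHom B D) (f : AlgebraHom A B) : AlgebraHom A D.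
Proof.
exists (alg_hom g ∘ alg_hom f).
now rewrite fmap_comp, comp_assoc, <- alg_hom_str, <- !comp_assoc, alg_hom_str.
Defined.

Definition EilenbergMoore (C : Category) (T : Monad C) : Category.
Proof.
refine {| Obj := Algebra T; Hom := @AlgebraHom C T;
          idm := @algebra_id C T; comp := @algebra_comp C T |}.
- intros; apply AlgebraHom_eq; apply comp_id_l.
- intros; apply AlgebraHom_eq; apply comp_id_r.
- intros; apply AlgebraHom_eq; apply comp_assoc.
Defined.

Definition em_forgetful (C : Category) (T : Monad C) :
  Functor (EilenbergMoore T) C.
Proof.
refine {| fobj := fun A : EilenbergMoore T => alg_obj A;
          fmap := fun (A B : EilenbergMoore T) (f : Hom A B) => alg_hom f |};
  reflexivity.
Defined.

Definition monadic (D C : Category) (G : Functor D C) : Prop :=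
  exists (T : Monad C) (K : Functor D (EilenbergMoore T)),
    is_equivalence K /\ nat_isomorphic (functor_comp (em_forgetful T) K) G.

(* The bounds are not required to be distinct. *)
Record BPoset : Type := {
  carrier :> Type;
  le : relation carrier;
  bot : carrier;
  top : carrier;
  le_order : order carrier le;
  bot_le : forall x, le bot x;
  le_top : forall x, le x top
}.

Arguments le {b} x y.
Arguments bot {b}.
Arguments top {b}.

Declare Scope poset_scope.
Open Scope poset_scope.
Notation "x '≤' y" := (le x y) (at level 70, no associativity) : poset_scope.

Definition is_join (P : BPoset) (x y z : P) : Prop :=
  x ≤ z /\ y ≤ z /\ (forall w : P, x ≤ w -> y ≤ w -> z ≤ w).

Definition is_meet (P : BPoset) (x y z : P) : Prop :=
  z ≤ x /\ z ≤ y /\ (forall w : P, w ≤ x -> w ≤ y -> w ≤ z).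

Record BPosetHom (P Q : BPoset) : Type := {
  bp_fun :> P -> Q;
  bp_isotone : forall x y : P, x ≤ y -> bp_fun x ≤ bp_fun y;
  bp_bot : bp_fun bot = bot;
  bp_top : bp_fun top = top
}.

Record BPosetInv : Type := {
  bposet :> BPoset;
  inv : bposet -> bposet;
  inv_antitone : forall x y : bposet, x ≤ y <-> inv y ≤ inv x;
  inv_invol : forall x : bposet, inv (inv x) = x
}.

Arguments inv {b} x.

Record BPosetInvHom (P Q : BPosetInv) : Type := {
  bpi_hom :> BPosetHom P Q;
  bpi_inv : forall x : P, bpi_hom (inv x) = inv (bpi_hom x)
}.

Lemma BPosetInvHom_eq (P Q : BPosetInv) (f g : BPosetInvHom P Q) :
  (forall x, f x = g x) -> f = g.
Proof.
destruct f as [[f f1 f2 f3] f4], g as [[g g1 g2 g3] g4]; simpl in *.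
intros H; assert (E : f = g) by (now apply functional_extensionality).
subst g.
rewrite (proof_irrelevance _ g1 f1), (proof_irrelevance _ g2 f2),
  (proof_irrelevance _ g3 f3) in *.
now rewrite (proof_irrelevance _ g4 f4).
Qed.

Definition bpi_id (P : BPosetInv) : BPosetInvHom P P.
Proof.
unshelve refine {| bpi_hom := {| bp_fun := fun x : P => x |} |}; auto.
Defined.

Definition bpi_comp (P Q R : BPosetInv)
  (g : BPosetInvHom Q R) (f : BPosetInvHom P Q) : BPosetInvHom P R.
Proof.
unshelve refine {| bpi_hom := {| bp_fun := fun x : P => g (f x) |} |}.
- intros x y Hxy; now apply bp_isotone, bp_isotone.
- now rewrite !bp_bot.
- now rewrite !bp_top.
- intros x; simpl; now rewrite !bpi_inv.
Defined.

Definition BPosInv : Category.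
Proof.
refine {| Obj := BPosetInv; Hom := BPosetInvHom;
          idm := bpi_id; comp := bpi_comp |};
  intros; now apply BPosetInvHom_eq.
Defined.

Definition orthogonal (P : BPosetInv) (x y : P) : Prop := x ≤ inv y.

Notation "x '⊥' y" := (orthogonal x y) (at level 70, no associativity)
  : poset_scope.

(* Joins are partial: an equation between terms with joins asserts that the
   joins exist, with the stated value. *)
Record OrthomodularPoset : Type := {
  omp_bpi :> BPosetInv;
  omp1 : forall x : omp_bpi, is_meet x (inv x) bot;
  omp2 : forall x y : omp_bpi, x ⊥ y -> exists z, is_join x y z;
  omp3 : forall x y : omp_bpi, x ≤ y ->
    exists z, is_join x (inv y) z /\ is_join x (inv z) y
}.

Record OMPHom (A B : OrthomodularPoset) : Type := {
  omp_hom :> BPosetInvHom A B;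
  omp_hom_orth : forall x y : A, x ⊥ y -> omp_hom x ⊥ omp_hom y;
  omp_hom_join : forall x y z : A, x ⊥ y -> is_join x y z ->
    is_join (omp_hom x) (omp_hom y) (omp_hom z)
}.

Lemma OMPHom_eq (A B : OrthomodularPoset) (f g : OMPHom A B) :
  omp_hom f = omp_hom g -> f = g.
Proof.
destruct f as [f f1 f2], g as [g g1 g2]; simpl; intros ->.
now rewrite (proof_irrelevance _ f1 g1), (proof_irrelevance _ f2 g2).
Qed.

Definition omp_id (A : OrthomodularPoset) : OMPHom A A.
Proof.
exists (bpi_id A); auto.
Defined.

Definition omp_comp (A B D : OrthomodularPoset)
  (g : OMPHom B D) (f : OMPHom A B) : OMPHom A D.
Proof.
exists (bpi_comp g f).
- intros x y H; now apply (omp_hom_orth g), (omp_hom_orth f).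
- intros x y z H J; apply (omp_hom_join g).
  + now apply (omp_hom_orth f).
  + now apply (omp_hom_join f).
Defined.

Definition OMP : Category.
Proof.
refine {| Obj := OrthomodularPoset; Hom := OMPHom;
          idm := omp_id; comp := omp_comp |};
  intros; apply OMPHom_eq; now apply BPosetInvHom_eq.
Defined.

Definition OMP_forgetful : Functor OMP BPosInv.
Proof.
refine {| fobj := (fun A : OrthomodularPoset => omp_bpi A) : OMP -> BPosInv;
          fmap := fun (A B : OMP) (f : Hom A B) => omp_hom f |};
  reflexivity.
Defined.

(* Main.v *)
Require Import Defs.
From Stdlib Require Import Relation_Definitions.
From Stdlib Require Import ProofIrrelevance FunctionalExtensionality
  PropExtensionality ClassicalEpsilon.

(** A left adjoint [F] of the forgetful functor [G] yields a monad [T = G F]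
    and a comparison functor from orthomodular posets to [T]-algebras, so two
    things are needed: every [T]-algebra is an orthomodular poset in a unique
    way ([comparison_algebra_OMP], [comparison_full]), and [F] exists
    ([free_omp_adjoint]).

    The first holds because orthogonality and joins are expressed by the order
    and the involution alone.  If [α : T X → X] is an algebra with unit [η] and
    [x ⊥ y] in [X], then [η x ∨ η y] exists in the free orthomodular poset
    [T X], and its image under the isotone retraction [α] of [η] is the join of
    [x] and [y] ([algebra_join]).  Associativity of the algebra upgrades this to
    the statement that [α] preserves every orthogonal join of [T X]
    ([structure_map_join]), so the orthomodular law is transported from [T X] to
    [X], and [α] is the morphism that the freeness of [T X] assigns to the
    identity of [X].  In the same way an isotone map that commutes with the
    structure maps of two algebras preserves orthogonal joins.  Being an
    orthomodular poset is a property of a bounded poset with involution, so the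
    comparison functor is in fact surjective on objects; a functor that is also
    full and faithful is then an equivalence.

    For the second, the axioms of orthomodular posets form a theory with a
    partial operation whose domain is given by an inequality, and such theories
    have free models.  [tle] is the inequality derivable from these axioms
    between terms over [P], and the terms [t] with [tle t t], up to mutual
    inequality, form the free orthomodular poset.  Every derivable inequality
    holds under every interpretation ([eval_le]), which gives the extension of a
    map on generators; it is unique by induction on terms, because in a defined
    term all subterms are defined and all joins are orthogonal ([tle_wf]). *)

Set Implicit Arguments.
Unset Strict Implicit.

(** * Fully faithful and essentially surjective functors *)

Definition full (C D : Category) (K : Functor C D) : Prop :=
  forall (X Y : C) (f : Hom (K X) (K Y)), exists g : Hom X Y, fmap K g = f.

Definition faithful (C D : Category) (K : Functor C D) : Prop :=
  forall (X Y : C) (f g : Hom X Y), fmap K f = fmap K g -> f = g.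

Definition isomorphic (C : Category) (X Y : C) : Prop :=
  exists (i : Hom X Y) (j : Hom Y X), j ∘ i = idm X /\ i ∘ j = idm Y.

Definition essentially_surjective (C D : Category) (K : Functor C D) : Prop :=
  forall Y : D, exists X : C, isomorphic (K X) Y.

Lemma dependent_choice (A : Type) (B : A -> Type) (R : forall a, B a -> Prop) :
  (forall a, exists b, R a b) -> exists f : forall a, B a, forall a, R a (f a).
Proof.
intros H; pose (c := fun a => constructive_indefinite_description _ (H a)).
exists (fun a => proj1_sig (c a)); intros a; exact (proj2_sig (c a)).
Qed.

(** The quasi-inverse picks an object [L Y] with an isomorphism
    [i : K (L Y) → Y] for every [Y]; fullness and faithfulness give the unique
    [L f] with [K (L f) = i⁻¹ f i]. *)
Lemma fully_faithful_eso_equivalence (C D : Category) (K : Functor C D) :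
  full K -> faithful K -> essentially_surjective K -> is_equivalence K.
Proof.
intros HF Hf HE.
destruct (dependent_choice HE) as [L0 HL].
destruct (dependent_choice HL) as [i Hi].
destruct (dependent_choice Hi) as [j Hj].
destruct (dependent_choice (fun X => dependent_choice (fun Y =>
  dependent_choice (HF X Y)))) as [pre Hpre].
pose proof (fun Y => proj1 (Hj Y)) as Hji.
pose proof (fun Y => proj2 (Hj Y)) as Hij.
clear HF HE HL Hi Hj.
assert (Hji' : forall Y W (g : Hom W (K (L0 Y))), j Y ∘ (i Y ∘ g) = g)
  by (intros; now rewrite comp_assoc, Hji, comp_id_l).
assert (Hij' : forall Y W (g : Hom W Y), i Y ∘ (j Y ∘ g) = g)
  by (intros; now rewrite comp_assoc, Hij, comp_id_l).
unshelve eset (L := {|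
  fobj := L0 : D -> C;
  fmap := fun Y Z (f : Hom Y Z) => pre _ _ (j Z ∘ (f ∘ i Y)) |} : Functor D C).
- intros Y; apply Hf; now rewrite Hpre, fmap_id, comp_id_l.
- intros X Y Z g f; apply Hf.
  now rewrite fmap_comp, !Hpre, <- !comp_assoc, Hij'.
- exists L; split.
  + unshelve eexists.
    { exists (fun X : C => pre (L0 (K X)) X (i (K X))).
      intros X Y f; simpl; apply Hf.
      now rewrite !fmap_comp, !Hpre, Hij'. }
    unshelve eexists.
    { exists (fun X : C => pre X (L0 (K X)) (j (K X))).
      intros X Y f; simpl; apply Hf.
      now rewrite !fmap_comp, !Hpre, <- !comp_assoc, Hij, comp_id_r. }
    intros X; simpl; split; apply Hf; rewrite fmap_comp, !Hpre, fmap_id; auto.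
  + unshelve eexists.
    { exists (fun Y : D => i Y).
      intros X Y f; simpl.
      now rewrite Hpre, Hij'. }
    unshelve eexists.
    { exists (fun Y : D => j Y).
      intros X Y f; simpl.
      now rewrite Hpre, <- !comp_assoc, Hij, comp_id_r. }
    intros X; simpl; auto.
Qed.

(** * The monad of an adjunction and its comparison functor *)

(** Universal arrows from every object of [C] to [G].  The functor [free] and
    the naturality of unit and counit follow from uniqueness of extensions. *)
Record LeftAdjoint (D C : Category) (G : Functor D C) : Type := {
  free : C -> D;
  eta : forall X : C, Hom X (G (free X));
  extend : forall (X : C) (A : D), Hom X (G A) -> Hom (free X) A;
  extend_eta : forall (X : C) (A : D) (f : Hom X (G A)),
    fmap G (extend f) ∘ eta X = f;
  free_hom_eq : forall (X : C) (A : D) (g h : Hom (free X) A),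
    fmap G g ∘ eta X = fmap G h ∘ eta X -> g = h
}.

Section Adjunction.

Variables (D C : Category) (G : Functor D C) (F : LeftAdjoint G).

Definition counit (A : D) : Hom (free F (G A)) A := extend F (idm (G A)).

Definition free_functor : Functor C D.
Proof.
refine {| fobj := free F;
          fmap := fun X Y (f : Hom X Y) => extend F (eta F Y ∘ f) |}.
- intros X; apply (free_hom_eq (l := F)).
  now rewrite extend_eta, fmap_id, comp_id_l, comp_id_r.
- intros X Y Z g f; apply (free_hom_eq (l := F)).
  now rewrite fmap_comp, <- comp_assoc, !extend_eta, !comp_assoc, extend_eta.
Defined.

(** Naturality and associativity of the multiplication, associativity of the
    comparison algebras and compatibility of the comparison morphisms are all
    images under [G] of instances of this square. *)
Lemma counit_natural (A B : D) (g : Hom A B) :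
  counit B ∘ fmap free_functor (fmap G g) = g ∘ counit A.
Proof.
apply (free_hom_eq (l := F)); simpl; unfold counit.
now rewrite !fmap_comp, <- !comp_assoc, !extend_eta, comp_assoc, extend_eta,
  comp_id_l, comp_id_r.
Qed.

Definition unit_trans :
  NatTrans (functor_id C) (functor_comp G free_functor).
Proof.
exists (eta F : forall X : C, Hom (functor_id C X) _).
intros X Y f; simpl; now rewrite extend_eta.
Defined.

Definition mult_trans :
  NatTrans (functor_comp (functor_comp G free_functor)
                         (functor_comp G free_functor))
           (functor_comp G free_functor).
Proof.
exists (fun X : C => fmap G (counit (free F X))).
intros X Y f.
exact (eq_trans (eq_sym (fmap_comp _ _ _))
  (eq_trans (f_equal (fmap G) (counit_natural (fmap free_functor f)))
    (fmap_comp _ _ _))).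
Defined.

Definition adjunction_monad : Monad C.
Proof.
refine {| unit_m := unit_trans; mult_m := mult_trans |}; intros X; simpl.
- apply extend_eta.
- rewrite <- fmap_comp, <- fmap_id; f_equal.
  apply (free_hom_eq (l := F)); unfold counit.
  now rewrite fmap_comp, <- comp_assoc, !extend_eta, comp_assoc, extend_eta,
    fmap_id.
- rewrite <- !fmap_comp; f_equal.
  symmetry; apply (counit_natural (counit (free F X))).
Defined.

Definition comparison_obj (A : D) : Algebra adjunction_monad.
Proof.
unshelve refine {| alg_obj := G A; alg_str := _ |}.
- exact (fmap G (counit A)).
- apply extend_eta.
- simpl; rewrite <- !fmap_comp; f_equal.
  symmetry; apply (counit_natural (counit A)).
Defined.

Definition comparison_map (A B : D) (g : Hom A B) :
  AlgebraHom (comparison_obj A) (comparison_obj B).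
Proof.
unshelve refine {| alg_hom := _ |}.
- exact (fmap G g).
- simpl; rewrite <- !fmap_comp; f_equal.
  symmetry; apply (counit_natural g).
Defined.

Definition comparison : Functor D (EilenbergMoore adjunction_monad).
Proof.
refine {| fobj := comparison_obj : D -> EilenbergMoore adjunction_monad;
          fmap := comparison_map |}.
- intros A; apply AlgebraHom_eq, fmap_id.
- intros A B E g f; apply AlgebraHom_eq, fmap_comp.
Defined.

Lemma forgetful_comparison :
  nat_isomorphic (functor_comp (em_forgetful adjunction_monad) comparison) G.
Proof.
pose (UK := functor_comp (em_forgetful adjunction_monad) comparison).
unshelve eexists.
{ exists (fun A : D => idm (G A) : Hom (UK A) (G A)).
  intros A B g; simpl; now rewrite comp_id_l, comp_id_r. }
unshelve eexists.
{ exists (fun A : D => idm (G A) : Hom (G A) (UK A)).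
  intros A B g; simpl; now rewrite comp_id_l, comp_id_r. }
intros A; simpl; split; apply comp_id_l.
Qed.

End Adjunction.

(** * Algebras over orthomodular posets *)

Lemma le_refl (P : BPoset) (x : P) : x ≤ x.
Proof. apply (ord_refl _ _ (le_order P)). Qed.

Lemma le_trans (P : BPoset) (x y z : P) : x ≤ y -> y ≤ z -> x ≤ z.
Proof. apply (ord_trans _ _ (le_order P)). Qed.

Lemma le_antisym (P : BPoset) (x y : P) : x ≤ y -> y ≤ x -> x = y.
Proof. apply (ord_antisym _ _ (le_order P)). Qed.

Lemma is_join_unique (P : BPoset) (x y z w : P) :
  is_join x y z -> is_join x y w -> z = w.
Proof.
intros (H1 & H2 & H3) (K1 & K2 & K3); apply le_antisym; auto.
Qed.

Lemma orthogonal_map (P Q : BPosetInv) (f : BPosetInvHom P Q) (x y : P) :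
  x ⊥ y -> f x ⊥ f y.
Proof.
unfold orthogonal; intros H; rewrite <- bpi_inv; now apply bp_isotone.
Qed.

Section OMPAlgebra.

Variable F : LeftAdjoint OMP_forgetful.

Let T := adjunction_monad F.

Definition gen_hom (P : BPosetInv) : BPosetInvHom P (free F P : OrthomodularPoset) :=
  eta F P.

Variable A : Algebra T.

Let X : BPosetInv := alg_obj A.
Let FX : OrthomodularPoset := free F X.

Definition structure_map : BPosetInvHom FX X := alg_str A.

Lemma structure_map_gen (x : X) : structure_map (gen_hom X x) = x.
Proof.
exact (f_equal (fun h : BPosetInvHom X X => h x) (alg_unit A)).
Qed.

(** An upper bound [w] of [x] and [y] gives the upper bound [η w] of their
    generators, so [j ≤ η w], and the structure map sends [η w] back to [w]. *)
Lemma algebra_join (x y : X) (j : FX) :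
  is_join (gen_hom X x) (gen_hom X y) j -> is_join x y (structure_map j).
Proof.
intros (H1 & H2 & H3); split; [|split].
- rewrite <- (structure_map_gen x); now apply bp_isotone.
- rewrite <- (structure_map_gen y); now apply bp_isotone.
- intros w Hx Hy; rewrite <- (structure_map_gen w); apply bp_isotone.
  apply H3; now apply bp_isotone.
Qed.

(** With [J] the join of the generators of [T (T X)] given by [a] and [b], the
    multiplication [m] sends [J] to [a ∨ b] and [T α] sends it to
    [η (α a) ∨ η (α b)], since both are morphisms of orthomodular posets.
    Associativity [α m = α (T α)] makes [α (a ∨ b)] equal to
    [α (η (α a) ∨ η (α b))], which is [α a ∨ α b] by [algebra_join]. *)
Lemma structure_map_join (a b c : FX) : a ⊥ b -> is_join a b c ->
  is_join (structure_map a) (structure_map b) (structure_map c).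
Proof.
intros Hab Hc.
destruct (omp2 (orthogonal_map (gen_hom FX) Hab)) as [J HJ].
pose (Ta := fmap (free_functor F) (alg_str A)
  : OMPHom (free F FX : OrthomodularPoset) FX).
pose (m := counit F (free F X) : OMPHom (free F FX : OrthomodularPoset) FX).
assert (Ta_gen : forall d : FX, Ta (gen_hom FX d) = gen_hom X (structure_map d)).
{ intros d.
  exact (f_equal (fun h : BPosetInvHom FX FX => h d)
    (eq_sym (naturality (unit_m T) (alg_str A)))). }
assert (m_gen : forall d : FX, m (gen_hom FX d) = d).
{ intros d.
  exact (f_equal (fun h : BPosetInvHom FX FX => h d)
    (mult_unit_l T X)). }
assert (E : structure_map (m J) = structure_map (Ta J))
  by exact (f_equal (fun h : BPosetInvHom (free F FX : OrthomodularPoset) X => h J)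
    (alg_mult A)).
pose proof (omp_hom_join m (orthogonal_map (gen_hom FX) Hab) HJ) as HmJ.
rewrite !m_gen in HmJ.
rewrite (is_join_unique Hc HmJ), E.
apply algebra_join; rewrite <- !Ta_gen.
now apply (omp_hom_join Ta (orthogonal_map (gen_hom FX) Hab)).
Qed.

Definition algebra_OMP : OrthomodularPoset.
Proof.
exists X.
- intros x; split; [|split]; try apply bot_le.
  intros w Hx Hx'.
  rewrite <- (structure_map_gen w), <- (bp_bot structure_map).
  apply bp_isotone.
  apply (omp1 (gen_hom X x)); [|rewrite <- bpi_inv]; now apply bp_isotone.
- intros x y H.
  destruct (omp2 (orthogonal_map (gen_hom X) H)) as [j Hj].
  exists (structure_map j); now apply algebra_join.
- intros x y H.
  destruct (omp3 (bp_isotone (gen_hom X) H)) as [j [Hj1 Hj2]].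
  exists (structure_map j); split.
  + apply algebra_join; now rewrite bpi_inv.
  + (* This join is not one of generators: preservation of all orthogonal
       joins is what transports the orthomodular law. *)
    rewrite <- (structure_map_gen x), <- (structure_map_gen y) at 1.
    rewrite <- bpi_inv.
    apply structure_map_join; trivial.
    unfold orthogonal; rewrite inv_invol; apply Hj1.
Defined.

Definition structure_OMPHom : OMPHom FX algebra_OMP.
Proof.
exists structure_map.
- apply (orthogonal_map structure_map).
- apply structure_map_join.
Defined.

(** Both sides are morphisms of orthomodular posets on the free one that
    restrict to the identity on generators. *)
Lemma structure_counit :
  alg_str A = fmap OMP_forgetful (counit F algebra_OMP).
Proof.
change (fmap OMP_forgetful (structure_OMPHom : Hom (free F X) (algebra_OMP : OMP))
  = fmap OMP_forgetful (counit F algebra_OMP)).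
f_equal.
apply (free_hom_eq (l := F)).
unfold counit; rewrite extend_eta.
apply (alg_unit A).
Qed.

End OMPAlgebra.

Lemma Algebra_eq (C : Category) (T : Monad C) (X : C) (a b : Hom (T X) X)
  (a_unit : a ∘ unit_m T X = idm X) (b_unit : b ∘ unit_m T X = idm X)
  (a_mult : a ∘ mult_m T X = a ∘ fmap T a)
  (b_mult : b ∘ mult_m T X = b ∘ fmap T b) :
  a = b -> Build_Algebra a_unit a_mult = Build_Algebra b_unit b_mult.
Proof.
intros E; subst b.
now rewrite (proof_irrelevance _ a_unit b_unit),
  (proof_irrelevance _ a_mult b_mult).
Qed.

Lemma comparison_algebra_OMP (F : LeftAdjoint OMP_forgetful)
  (A : Algebra (adjunction_monad F)) : comparison F (algebra_OMP A) = A.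
Proof.
pose proof (structure_counit A) as E.
destruct A as [X a a_unit a_mult].
symmetry; exact (Algebra_eq _ _ _ _ E).
Qed.

Lemma comparison_essentially_surjective (F : LeftAdjoint OMP_forgetful) :
  essentially_surjective (comparison F).
Proof.
intros A; exists (algebra_OMP A).
rewrite comparison_algebra_OMP.
exists (idm A), (idm A); split; apply comp_id_l.
Qed.

Lemma comparison_faithful (F : LeftAdjoint OMP_forgetful) :
  faithful (comparison F).
Proof.
intros A B f g E; apply OMPHom_eq.
exact (f_equal (@alg_hom _ _ _ _) E).
Qed.

(** If [h] commutes with the structure maps, then [h (x ∨ y)] is the image of
    [η (h x) ∨ η (h y)] under the structure map of [B], as [T h] preserves joins
    and generators. *)
Lemma comparison_full (F : LeftAdjoint OMP_forgetful) :
  full (comparison F).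
Proof.
intros A B f.
pose (h := alg_hom f : BPosetInvHom (A : OrthomodularPoset) (B : OrthomodularPoset)).
pose (KA := comparison F A : Algebra (adjunction_monad F)).
pose (KB := comparison F B : Algebra (adjunction_monad F)).
assert (Hj : forall x y z : (A : OrthomodularPoset), x ⊥ y -> is_join x y z ->
  is_join (h x) (h y) (h z)).
{ intros x y z Hxy Hz.
  destruct (omp2 (orthogonal_map (gen_hom F A) Hxy)) as [j Hj].
  rewrite (is_join_unique Hz (algebra_join (A := KA) Hj)).
  pose (Th := fmap (free_functor F) (alg_hom f) : OMPHom
    (free F (A : OrthomodularPoset) : OrthomodularPoset)
    (free F (B : OrthomodularPoset) : OrthomodularPoset)).
  assert (E : h (structure_map KA j) = structure_map KB (Th j)).
  { exact (f_equal (fun k : BPosetInvHom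
      (free F (A : OrthomodularPoset) : OrthomodularPoset)
      (B : OrthomodularPoset) => k j) (alg_hom_str f)). }
  rewrite E; apply (algebra_join (A := KB)).
  assert (Th_gen : forall d : (A : OrthomodularPoset),
    Th (gen_hom F A d) = gen_hom F B (h d)).
  { intros d.
    exact (f_equal (fun k : BPosetInvHom (A : OrthomodularPoset)
      (free F (B : OrthomodularPoset) : OrthomodularPoset) => k d)
      (eq_sym (naturality (unit_m (adjunction_monad F)) (alg_hom f)))). }
  pose proof (omp_hom_join Th (orthogonal_map (gen_hom F A) Hxy) Hj) as H.
  now rewrite !Th_gen in H. }
exists {| omp_hom := h; omp_hom_orth := orthogonal_map h; omp_hom_join := Hj |}.
now apply AlgebraHom_eq.
Qed.

Lemma left_adjoint_monadic : LeftAdjoint OMP_forgetful -> monadic OMP_forgetful.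
Proof.
intros F; exists (adjunction_monad F), (comparison F); split.
- apply fully_faithful_eso_equivalence.
  + apply comparison_full.
  + apply comparison_faithful.
  + apply comparison_essentially_surjective.
- apply forgetful_comparison.
Qed.

(** * The free orthomodular poset *)

Section Terms.

Variable P : BPosetInv.

Inductive term : Type :=
| Gen (p : P)
| Inv (t : term)
| Join (t s : term).

(** [tle t s] is to entail that both terms are defined, where [Join t s] is
    defined when [t ⊥ s].  Hence reflexivity is not a rule, and rules that
    introduce a term ask for its definedness in the form [tle t t].  The
    orthomodular law is listed as one inequality because its converse follows
    from [t ≤ s] and [s' ≤ t ∨ s']. *)
Inductive tle : term -> term -> Prop :=
| tle_gen p q : p ≤ q -> tle (Gen p) (Gen q)
| tle_trans t s u : tle t s -> tle s u -> tle t u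
| tle_bot t : tle t t -> tle (Gen bot) t
| tle_top t : tle t t -> tle t (Gen top)
| tle_inv t s : tle t s -> tle (Inv s) (Inv t)
| tle_invol_l t : tle t t -> tle (Inv (Inv t)) t
| tle_invol_r t : tle t t -> tle t (Inv (Inv t))
| tle_gen_inv_l p : tle (Gen (inv p)) (Inv (Gen p))
| tle_gen_inv_r p : tle (Inv (Gen p)) (Gen (inv p))
| tle_join_l t s : tle t (Inv s) -> tle t (Join t s)
| tle_join_r t s : tle t (Inv s) -> tle s (Join t s)
| tle_join_lub t s u :
    tle t (Inv s) -> tle t u -> tle s u -> tle (Join t s) u
| tle_meet t u : tle u t -> tle u (Inv t) -> tle u (Gen bot)
| tle_orthomodular t s :
    tle t s -> tle s (Join t (Inv (Join t (Inv s)))).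

Lemma tle_join_refl (t s : term) :
  tle t (Inv s) -> tle (Join t s) (Join t s).
Proof.
intros H; apply tle_join_lub; trivial;
  [now apply tle_join_l|now apply tle_join_r].
Qed.

(** Inversion for definedness: the transitivity rule hides the subterms of [t]
    in a derivation of [tle t t], so orthogonality of the joins in [t] is
    recorded by recursion on [t] instead. *)
Fixpoint wf (t : term) : Prop :=
  match t with
  | Gen _ => True
  | Inv t => wf t
  | Join t s => wf t /\ wf s /\ tle t (Inv s)
  end.

Lemma wf_refl (t : term) : wf t -> tle t t.
Proof.
induction t as [p|t IH|t IHt s IHs]; simpl.
- intros _; apply tle_gen, le_refl.
- intros H; apply tle_inv; auto.
- intros (_ & _ & H); now apply tle_join_refl.
Qed.

(** The orthogonality that makes the right-hand side of [tle_orthomodular]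
    defined. *)
Lemma tle_orthomodular_orth (t s : term) : wf s -> tle t s ->
  tle t (Inv (Inv (Join t (Inv s)))).
Proof.
intros Hs H.
assert (Ho : tle t (Inv (Inv s)))
  by (eapply tle_trans; [exact H|apply tle_invol_r; now apply wf_refl]).
eapply tle_trans; [apply tle_join_l; exact Ho|].
now apply tle_invol_r, tle_join_refl.
Qed.

Lemma tle_wf (t s : term) : tle t s -> wf t /\ wf s.
Proof.
induction 1; simpl in *; repeat match goal with H : _ /\ _ |- _ => destruct H end;
  repeat split; trivial.
- eapply tle_trans; [eassumption|]; apply tle_invol_r; now apply wf_refl.
- now apply tle_orthomodular_orth.
Qed.

(** The quotient of the defined terms by mutual inequality, with the class of
    [t] represented by the down-set of [t]: propositional extensionality then
    turns equivalence of terms into equality of classes. *)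
Definition free_carrier : Type :=
  {c : term -> Prop | exists t, tle t t /\ c = (fun s => tle s t)}.

Definition cls (t : term) (H : tle t t) : free_carrier :=
  exist _ (fun s => tle s t) (ex_intro _ t (conj H eq_refl)).

Definition rep (c : free_carrier) : term :=
  proj1_sig (constructive_indefinite_description _ (proj2_sig c)).

Lemma rep_spec (c : free_carrier) :
  tle (rep c) (rep c) /\ proj1_sig c = (fun s => tle s (rep c)).
Proof.
exact (proj2_sig (constructive_indefinite_description _ (proj2_sig c))).
Qed.

Definition rep_refl (c : free_carrier) : tle (rep c) (rep c) :=
  proj1 (rep_spec c).

Lemma tle_rep (t s : term) (H : tle t t) : tle s (rep (cls H)) <-> tle s t.
Proof.
pose proof (f_equal (fun f => f s) (proj2 (rep_spec (cls H)))) as E.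
simpl in E; now rewrite E.
Qed.

Lemma rep_tle (t s : term) (H : tle t t) : tle (rep (cls H)) s <-> tle t s.
Proof.
split; apply tle_trans.
- now apply (tle_rep _ H).
- apply (tle_rep _ H), rep_refl.
Qed.

Definition free_le (c d : free_carrier) : Prop := tle (rep c) (rep d).

Lemma free_le_order : order free_carrier free_le.
Proof.
split.
- intros c; apply rep_refl.
- intros c d e; apply tle_trans.
- intros c d H K.
  assert (E : proj1_sig c = proj1_sig d).
  { rewrite (proj2 (rep_spec c)), (proj2 (rep_spec d)).
    apply functional_extensionality; intros s.
    apply propositional_extensionality; split; intros L;
      eapply tle_trans; eassumption. }
  destruct c as [c Hc], d as [d Hd]; simpl in E; subst d.
  now rewrite (proof_irrelevance _ Hc Hd).
Qed.

Lemma free_le_cls (t s : term) (Ht : tle t t) (Hs : tle s s) :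
  free_le (cls Ht) (cls Hs) <-> tle t s.
Proof. unfold free_le; now rewrite tle_rep, rep_tle. Qed.

Lemma cls_rep (c : free_carrier) : cls (rep_refl c) = c.
Proof.
apply (ord_antisym _ _ free_le_order); [apply rep_tle|apply tle_rep];
  apply rep_refl.
Qed.

Lemma gen_refl (p : P) : tle (Gen p) (Gen p).
Proof. apply tle_gen, le_refl. Qed.

Definition free_bposet : BPoset.
Proof.
refine {| le := free_le; bot := cls (gen_refl bot); top := cls (gen_refl top);
          le_order := free_le_order |}.
- intros c; apply rep_tle, tle_bot, rep_refl.
- intros c; apply tle_rep, tle_top, rep_refl.
Defined.

Definition free_inv (c : free_bposet) : free_bposet :=
  cls (tle_inv (rep_refl c)).

Lemma free_inv_invol (c : free_bposet) : free_inv (free_inv c) = c.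
Proof.
rewrite <- (cls_rep c) at 2; apply le_antisym; apply free_le_cls.
- eapply tle_trans; [|apply tle_invol_l, rep_refl].
  apply tle_inv, tle_rep, tle_inv, rep_refl.
- eapply tle_trans; [apply tle_invol_r, rep_refl|].
  apply tle_inv, rep_tle, tle_inv, rep_refl.
Qed.

Lemma free_inv_le (c d : free_bposet) : c ≤ d -> free_inv d ≤ free_inv c.
Proof. intros H; now apply free_le_cls, tle_inv. Qed.

Definition free_bposet_inv : BPosetInv.
Proof.
exists free_bposet free_inv.
- intros c d; split; [apply free_inv_le|].
  intros H; rewrite <- (free_inv_invol c), <- (free_inv_invol d).
  now apply free_inv_le.
- apply free_inv_invol.
Defined.

Lemma le_inv_rep (c d : free_bposet_inv) :
  c ≤ inv d <-> tle (rep c) (Inv (rep d)).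
Proof. apply tle_rep. Qed.

Lemma inv_cls (t : term) (Ht : tle t t) (Hi : tle (Inv t) (Inv t)) :
  inv (cls Ht : free_bposet_inv) = cls Hi.
Proof.
apply le_antisym; apply free_le_cls; apply tle_inv;
  [apply tle_rep|apply rep_tle]; trivial.
Qed.

Lemma orthogonal_cls (t s : term) (Ht : tle t t) (Hs : tle s s) :
  tle t (Inv s) -> orthogonal (P := free_bposet_inv) (cls Ht) (cls Hs).
Proof.
intros H; unfold orthogonal.
rewrite (inv_cls Hs (tle_inv Hs)); now apply free_le_cls.
Qed.

Lemma is_join_cls (t s : term) (Ht : tle t t) (Hs : tle s s)
  (Hj : tle (Join t s) (Join t s)) : tle t (Inv s) ->
  is_join (P := free_bposet) (cls Ht) (cls Hs) (cls Hj).
Proof.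
intros H; split; [|split].
- now apply free_le_cls, tle_join_l.
- now apply free_le_cls, tle_join_r.
- intros w; rewrite <- (cls_rep w); simpl; rewrite !free_le_cls.
  now apply tle_join_lub.
Qed.

Lemma free_omp1 (x : free_bposet_inv) : is_meet x (inv x) bot.
Proof.
split; [apply bot_le|split; [apply bot_le|]].
intros w Hx Hx'; apply tle_rep, tle_meet with (rep x); trivial.
now apply le_inv_rep.
Qed.

Lemma join_refl (x y : free_bposet_inv) : x ⊥ y ->
  tle (Join (rep x) (rep y)) (Join (rep x) (rep y)).
Proof. intros H; exact (tle_join_refl (proj1 (le_inv_rep x y) H)). Qed.

Lemma is_join_rep (x y : free_bposet_inv) (H : x ⊥ y) :
  is_join x y (cls (join_refl H)).
Proof.
rewrite <- (cls_rep x) at 1; rewrite <- (cls_rep y) at 1.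
apply is_join_cls, (proj1 (le_inv_rep x y) H).
Qed.

Lemma free_omp3 (x y : free_bposet_inv) : x ≤ y ->
  exists z, is_join x (inv y) z /\ is_join x (inv z) y.
Proof.
intros H.
pose (Hs := tle_inv (rep_refl y)).
assert (Ho : tle (rep x) (Inv (Inv (rep y)))).
{ eapply tle_trans; [exact H|apply tle_invol_r, rep_refl]. }
pose proof (tle_join_refl Ho) as Hj.
assert (J : is_join x (inv y) (cls Hj)).
{ rewrite <- (cls_rep x) at 1.
  change (inv y) with (cls Hs); now apply is_join_cls. }
exists (cls Hj); split; [exact J|].
split; [exact H|split].
- rewrite <- (inv_invol y), <- inv_antitone; apply J.
- intros w Hx Hz.
  rewrite <- (cls_rep x) in Hx; rewrite <- (cls_rep w) in Hx, Hz |- *.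
  rewrite <- (cls_rep y).
  rewrite (inv_cls Hj (tle_inv Hj)) in Hz.
  simpl in Hx, Hz |- *; apply free_le_cls in Hx, Hz; apply free_le_cls.
  eapply tle_trans; [apply tle_orthomodular; exact H|].
  apply tle_join_lub; trivial.
  apply tle_orthomodular_orth; trivial.
  apply (tle_wf (rep_refl y)).
Qed.

Definition free_omp : OrthomodularPoset.
Proof.
exists free_bposet_inv.
- apply free_omp1.
- intros x y H; exists (cls (join_refl H)); apply is_join_rep.
- apply free_omp3.
Defined.

Definition gen_class (p : P) : free_omp := cls (gen_refl p).

Definition free_unit : BPosetInvHom P free_omp.
Proof.
unshelve refine {| bpi_hom := {| bp_fun := gen_class : P -> omp_bpi free_omp |} |}.
- intros p q H; now apply free_le_cls, tle_gen.
- reflexivity.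
- reflexivity.
- intros p; simpl.
  assert (H : tle (Inv (Gen p)) (Inv (Gen p))) by apply tle_inv, gen_refl.
  change (gen_class (inv p) = inv (cls (gen_refl p) : free_bposet_inv)).
  rewrite (inv_cls _ H).
  apply (@le_antisym free_bposet); apply free_le_cls;
    [apply tle_gen_inv_l|apply tle_gen_inv_r].
Defined.

(** Induction on terms: by [tle_wf] a defined join is the join of the classes
    of two orthogonal defined terms, and morphisms preserve it. *)
Lemma free_omp_hom_eq (A : OrthomodularPoset) (g h : OMPHom free_omp A) :
  (forall p, g (gen_class p) = h (gen_class p)) -> g = h.
Proof.
intros E; apply OMPHom_eq, BPosetInvHom_eq.
assert (K : forall t (Ht : tle t t), g (cls Ht) = h (cls Ht)).
{ induction t as [p|t IH|t IHt s IHs]; intros H.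
  - rewrite (proof_irrelevance _ H (gen_refl p)); apply E.
  - assert (Ht : tle t t) by apply wf_refl, (tle_wf H).
    rewrite <- (inv_cls Ht H).
    change (g (inv (cls Ht : free_omp)) = h (inv (cls Ht : free_omp))).
    now rewrite !bpi_inv, IH.
  - destruct (tle_wf H) as [(Wt & Ws & O) _].
    pose proof (wf_refl Wt) as Ht; pose proof (wf_refl Ws) as Hs.
    pose proof (orthogonal_cls Ht Hs O) as Oc.
    pose proof (is_join_cls Ht Hs H O) as J.
    pose proof (omp_hom_join g Oc J) as Jg.
    pose proof (omp_hom_join h Oc J) as Jh.
    rewrite IHt, IHs in Jg.
    exact (is_join_unique Jg Jh). }
intros c; rewrite <- (cls_rep c); apply K.
Qed.

Section Extension.

Variables (A : OrthomodularPoset) (f : BPosetInvHom P A).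

(** A total function, so that all terms can be interpreted; its values at
    non-orthogonal pairs are never met in the interpretation of a derivation. *)
Definition some_join (x y : A) : A := epsilon (inhabits bot) (is_join x y).

Lemma some_join_spec (x y : A) : x ⊥ y -> is_join x y (some_join x y).
Proof. intros H; exact (epsilon_spec (inhabits bot) (is_join x y) (omp2 H)). Qed.

Fixpoint eval (t : term) : A :=
  match t with
  | Gen p => f p
  | Inv t => inv (eval t)
  | Join t s => some_join (eval t) (eval s)
  end.

(** Soundness: each rule is an axiom of orthomodular posets, and the
    orthogonality premises guarantee that the joins in question exist. *)
Lemma eval_le (t s : term) : tle t s -> eval t ≤ eval s.
Proof.
induction 1; simpl in *.
- now apply bp_isotone.
- eapply le_trans; eassumption.
- rewrite bp_bot; apply bot_le.
- rewrite bp_top; apply le_top.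
- now rewrite <- inv_antitone.
- rewrite inv_invol; apply le_refl.
- rewrite inv_invol; apply le_refl.
- rewrite bpi_inv; apply le_refl.
- rewrite bpi_inv; apply le_refl.
- now apply some_join_spec.
- now apply some_join_spec.
- now apply some_join_spec.
- rewrite bp_bot; now apply (omp1 (eval t)).
- destruct (omp3 IHtle) as (z & Hz & Hy).
  assert (O : eval t ⊥ inv (eval s))
    by (unfold orthogonal; now rewrite inv_invol).
  rewrite (is_join_unique (some_join_spec O) Hz).
  assert (O' : eval t ⊥ inv z)
    by (unfold orthogonal; rewrite inv_invol; apply Hz).
  rewrite (is_join_unique (some_join_spec O') Hy); apply le_refl.
Qed.

Lemma eval_rep_cls (t : term) (H : tle t t) : eval (rep (cls H)) = eval t.
Proof.
apply le_antisym; apply eval_le; [apply rep_tle|apply tle_rep]; trivial.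
Qed.

Definition free_extend : OMPHom free_omp A.
Proof.
assert (HJ : forall x y z : free_omp, x ⊥ y -> is_join x y z ->
  is_join (eval (rep x)) (eval (rep y)) (eval (rep z))).
{ intros x y z H Hz.
  rewrite (is_join_unique Hz (is_join_rep H)), eval_rep_cls.
  apply some_join_spec, (eval_le (proj1 (le_inv_rep x y) H)). }
unshelve refine {| omp_hom := {| bpi_hom :=
  {| bp_fun := fun c : omp_bpi free_omp => eval (rep c) |} |} |}; trivial.
- intros c d; apply eval_le.
- exact (eq_trans (eval_rep_cls (gen_refl bot)) (bp_bot f)).
- exact (eq_trans (eval_rep_cls (gen_refl top)) (bp_top f)).
- intros c; apply eval_rep_cls.
- intros c d H; apply (eval_le (proj1 (le_inv_rep c d) H)).
Defined.

Lemma free_extend_gen (p : P) : free_extend (gen_class p) = f p.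
Proof. exact (eval_rep_cls (gen_refl p)). Qed.

End Extension.

End Terms.

Definition free_omp_adjoint : LeftAdjoint OMP_forgetful.
Proof.
refine (@Build_LeftAdjoint OMP BPosInv OMP_forgetful
  free_omp free_unit (fun P A f => free_extend f) _ _).
- intros P A f; apply BPosetInvHom_eq; intros p; apply free_extend_gen.
- intros P A g h E; apply free_omp_hom_eq; intros p.
  exact (f_equal (fun k : BPosetInvHom P (A : OrthomodularPoset) => k p) E).
Defined.

Theorem theorem4 : monadic OMP_forgetful.
Proof. exact (left_adjoint_monadic free_omp_adjoint). Qed.
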